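(* Let $\alpha>0$ and $\beta\ge 0$ be such that $\alpha+\beta>1$, let $X$ be a complex Banach space and let $T\in B(X)$ be an $(\alpha,\beta)$-RK operator. For any $k\in\mathbb{N}\cup\{0\}$ the following hold: (1) If $k<\alpha-1$, then $\|T^n(I-T)^k\| = O\big(n^{\alpha+\beta-k-1}\big)$. (2) If $k=\lceil \alpha-1\rceil$, then $$\|T^n(I-T)^k\| = \begin{cases} O\big(n^{\beta}\log(n+1)\big), & \text{if } \alpha\in\mathbb{N},\\ O\big(n^{\beta}\big), & \text{if } \alpha\notin\mathbb{N}.\end{cases}$$
   Context: $\mathbb{N}=\{1,2,\dots\}$; $B(X)$ is the algebra of bounded linear operators on $X$; $\mathbb{D}$ is the open unit disk; $R(\lambda,T)=(\lambda I-T)^{-1}$. $T\in B(X)$ is an $(\alpha,\beta)$-RK operator if $\sigma(T)\subset\overline{\mathbb{D}}$ and there is $C>0$ with $\|R(\lambda,T)\|\le\frac{C}{|\lambda-1|^{\alpha}(|\lambda|-1)^{\beta}}$ for all $1<|\lambda|<2$ (the limiting case $\beta=0$ is allowed). For nonnegative sequences, $a_n=O(b_n)$ means there is $C>0$ with $a_n\le C b_n$ for all $n\ge1$. *)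

(* Defs.v *)
From Stdlib Require Import Reals.
From Coquelicot Require Import Coquelicot.
Open Scope R_scope.

(* The bounded linear operators on [X] are the maps [T : X -> X] satisfying
   Coquelicot's [is_linear], which includes boundedness. *)

Section Operators.

Context {X : NormedModule C_AbsRing}.

(* Meaningful for bounded [T] only: [real] sends an infinite supremum to 0. *)
Definition op_norm (T : X -> X) : R :=
  real (Lub_Rbar (fun r => exists x : X, norm x <= 1 /\ r = norm (T x))).

Definition op_pow (T : X -> X) (n : nat) : X -> X := Nat.iter n T.

Definition scalar_minus (lam : C) (T : X -> X) : X -> X :=
  fun x => minus (scal (lam : C_AbsRing) x) (T x).

Definition is_resolvent (lam : C) (T S : X -> X) : Prop :=
  is_linear S /\
  (forall x, S (scalar_minus lam T x) = x) /\
  (forall x, scalar_minus lam T (S x) = x).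

Definition spectrum (T : X -> X) (lam : C) : Prop :=
  ~ exists S : X -> X, is_resolvent lam T S.

(* The resolvent is unique when it exists, and it exists for [1 < Cmod lam] by
   the condition on the spectrum, so [forall S] ranges over exactly one
   operator. *)
Definition RK_operator (alpha beta : R) (T : X -> X) : Prop :=
  is_linear T /\
  (forall lam : C, spectrum T lam -> Cmod lam <= 1) /\
  exists K : R, 0 < K /\
    forall lam : C, 1 < Cmod lam < 2 ->
    forall S : X -> X, is_resolvent lam T S ->
    op_norm S <=
      K / (Rpower (Cmod (lam - 1)%C) alpha * Rpower (Cmod lam - 1) beta).

End Operators.

Definition bigO (a b : nat -> R) : Prop :=
  exists K : R, 0 < K /\ forall n : nat, (1 <= n)%nat -> a n <= K * b n.

(* Main.v *)
(* The contour integral of the classical argument is replaced by an exact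
   finite sum.  For the points [l_j = r e^(2 pi i j / N)] one has, whenever
   [n + k < N],
     [T^n (I - T)^k = 1/N sum_j l_j^(n+1) (1 - l_j)^k R(l_j, T) (I - T^N / r^N)].
   The factor [I - T^N / r^N] is harmless for large [N]: the same formula with
   [n = k = 0] says that the means [F_r = 1/N sum_j l_j R(l_j, T)] invert it, so
   [T^N / r^N] is small exactly when [F_r] is close to the identity.  The means
   are Lipschitz in [r] uniformly in [N], hence this property passes from a large
   radius down to every [r > 1] in steps of fixed length (Rickart's elementary
   proof of the spectral radius formula).  Taking [r = 1 + 1/(2n)] and
   [N = n L], and grouping the points into [n] arcs, the resolvent condition
   bounds the sum by a multiple of
   [n^(alpha+beta-k-1) sum_(m <= n) m^(k-alpha)]. *)

Require Import Defs.
From Stdlib Require Import Reals.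
From Coquelicot Require Import Coquelicot.
From Stdlib Require Import ZArith Lra Lia Classical ClassicalEpsilon.
Open Scope R_scope.

(** * Finite sums and points on circles *)

(** Defined over monoids so that one set of lemmas serves real bounds, complex weights and
    vectors. *)
Fixpoint psum {G : AbelianMonoid} (u : nat -> G) (n : nat) : G :=
  match n with
  | 0%nat => zero
  | S m => plus (psum u m) (u m)
  end.

Lemma psum_ext {G : AbelianMonoid} (u v : nat -> G) (n : nat) :
  (forall j, (j < n)%nat -> u j = v j) -> psum u n = psum v n.
Proof.
induction n as [|n IH]; intros H; simpl; [easy|].
now rewrite IH, H; [|lia|intros; apply H; lia].
Qed.

Lemma psum_plus {G : AbelianMonoid} (u v : nat -> G) (n : nat) :
  psum (fun j => plus (u j) (v j)) n = plus (psum u n) (psum v n).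
Proof.
induction n as [|n IH]; simpl; [now rewrite plus_zero_l|].
rewrite IH, <- !plus_assoc; f_equal.
rewrite !plus_assoc; f_equal; apply plus_comm.
Qed.

Lemma psum_morph {G H : AbelianMonoid} (f : G -> H) (u : nat -> G) (n : nat) :
  f zero = zero -> (forall x y, f (plus x y) = plus (f x) (f y)) ->
  f (psum u n) = psum (fun j => f (u j)) n.
Proof.
intros H0 Hp; induction n as [|n IH]; simpl; [easy|].
now rewrite Hp, IH.
Qed.

Lemma psum_add {G : AbelianMonoid} (u : nat -> G) (n m : nat) :
  psum u (n + m) = plus (psum u n) (psum (fun j => u (n + j)%nat) m).
Proof.
induction m as [|m IH]; simpl.
- now rewrite Nat.add_0_r, plus_zero_r.
- now rewrite Nat.add_succ_r; simpl; rewrite IH, plus_assoc.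
Qed.

Lemma psum_le (u v : nat -> R) (n : nat) :
  (forall j, (j < n)%nat -> u j <= v j) -> psum u n <= psum v n.
Proof.
induction n as [|n IH]; intros H; simpl; [apply Rle_refl|].
apply Rplus_le_compat; [apply IH; intros; apply H|apply H]; lia.
Qed.

Lemma psum_const (c : R) (n : nat) : psum (fun _ => c) n = INR n * c.
Proof.
induction n as [|n IH]; [simpl; change (0 = 0 * c); ring|].
rewrite S_INR; simpl; rewrite IH; change (INR n * c + c = (INR n + 1) * c); ring.
Qed.

Lemma psum_mult_l (c : R) (u : nat -> R) (n : nat) :
  psum (fun j => c * u j) n = c * psum u n.
Proof.
symmetry; apply (psum_morph (Rmult c)); [apply Rmult_0_r|].
intros x y; apply Rmult_plus_distr_l.
Qed.

Lemma psum_block (h : nat -> R) (n L : nat) : (0 < L)%nat ->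
  psum (fun j => h (j / L)%nat) (n * L) = INR L * psum h n.
Proof.
intros HL; induction n as [|n IH]; simpl; [now rewrite Rmult_0_r|].
rewrite Nat.add_comm, psum_add, IH.
rewrite (psum_ext _ (fun _ => h n) L).
- rewrite psum_const; change (INR L * psum h n + INR L * h n = INR L * (psum h n + h n)); ring.
- intros j Hj; f_equal.
  rewrite Nat.add_comm, Nat.div_add, Nat.div_small; lia.
Qed.

Lemma psum_rev (h : nat -> R) (n : nat) :
  psum (fun m => h (n - m)%nat) n = psum (fun m => h (S m)) n.
Proof.
induction n as [|n IH]; [easy|].
(* Only the upper bound on the left is rewritten, which splits off the term [m = 0]; what remains is
   the sum for [n]. *)
change (S n) with (1 + n)%nat at 2; rewrite psum_add; simpl.
rewrite plus_zero_l, <- IH, plus_comm; easy.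
Qed.

(** * Polar coordinates and roots of unity *)

Definition polar (r t : R) : C := (r * cos t, r * sin t).

Lemma Cmod_polar (r t : R) : 0 <= r -> Cmod (polar r t) = r.
Proof.
intros Hr; unfold Cmod, polar; simpl fst; simpl snd.
replace ((r * cos t) ^ 2 + (r * sin t) ^ 2) with (r ^ 2 * (Rsqr (sin t) + Rsqr (cos t)))
  by (unfold Rsqr; ring).
rewrite sin2_cos2, Rmult_1_r; now apply sqrt_pow2.
Qed.

Lemma polar_pow (r t : R) (e : nat) : (polar r t ^ e)%C = polar (r ^ e) (INR e * t).
Proof.
induction e as [|e IH].
- unfold polar; simpl; rewrite Rmult_0_l, cos_0, sin_0; unfold RtoC; f_equal; ring.
- rewrite Cpow_S, IH, S_INR.
  replace ((INR e + 1) * t) with (t + INR e * t) by ring.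
  unfold polar, Cmult; simpl; rewrite cos_plus, sin_plus; f_equal; ring.
Qed.

Lemma Rabs_sin_le (x : R) : Rabs (sin x) <= Rabs x.
Proof.
destruct (Rle_lt_dec 1 (Rabs x)) as [H|H].
- apply Rle_trans with 1; [|easy].
  apply Rabs_le; destruct (SIN_bound x); lra.
- assert (Hp : forall y, 0 < y < 1 -> Rabs (sin y) <= y).
  { intros y Hy; rewrite Rabs_pos_eq; [apply Rlt_le, sin_lt_x; lra|].
    apply sin_ge_0; generalize PI2_1; lra. }
  destruct (Rtotal_order x 0) as [H0|[H0|H0]].
  + rewrite <- (Rabs_Ropp (sin x)), <- sin_neg, (Rabs_left x) by lra.
    rewrite Rabs_left in H by lra; apply Hp; lra.
  + rewrite H0, sin_0; apply Rle_refl.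
  + rewrite Rabs_pos_eq in H by lra; rewrite (Rabs_pos_eq x) by lra; apply Hp; lra.
Qed.

Lemma Cmod_polar_minus_angle (r t u : R) : 0 <= r ->
  Cmod (polar r t - polar r u)%C = 2 * r * Rabs (sin ((t - u) / 2)).
Proof.
intros Hr; rewrite <- (sqrt_Rsqr (2 * r * _)).
2: { apply Rmult_le_pos; [lra|apply Rabs_pos]. }
unfold Cmod, polar; simpl fst; simpl snd; f_equal.
rewrite Rsqr_mult, <- Rsqr_abs.
assert (H1 : cos t * cos u + sin t * sin u = 1 - 2 * Rsqr (sin ((t - u) / 2))).
{ rewrite <- cos_minus.
  replace (t - u) with (2 * ((t - u) / 2)) at 1 by field.
  rewrite cos_2a_sin; unfold Rsqr; ring. }
generalize (sin2_cos2 t) (sin2_cos2 u); revert H1; unfold Rsqr.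
intros H1 H2 H3.
replace ((r * cos t + - (r * cos u)) ^ 2 + (r * sin t + - (r * sin u)) ^ 2) with
  (r * r * ((sin t * sin t + cos t * cos t) + (sin u * sin u + cos u * cos u)
            - 2 * (cos t * cos u + sin t * sin u))) by ring.
rewrite H1, H2, H3; ring.
Qed.

Lemma Cmod_polar_minus_radius (r s t : R) :
  Cmod (polar r t - polar s t)%C = Rabs (r - s).
Proof.
rewrite <- sqrt_Rsqr_abs; unfold Cmod, polar; simpl fst; simpl snd; f_equal.
replace (Rsqr (r - s)) with (Rsqr (r - s) * (Rsqr (sin t) + Rsqr (cos t)))
  by (rewrite sin2_cos2; ring).
unfold Rsqr; ring.
Qed.

(** Go through [polar s t]: first along the radius, then along a chord of the circle of radius [s].
    This turns closeness in the coordinates into closeness in the plane, as the compactness argument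
    requires. *)
Lemma Cmod_polar_minus_le (r s t u : R) : 0 <= s ->
  Cmod (polar r t - polar s u)%C <= Rabs (r - s) + s * Rabs (t - u).
Proof.
intros Hs.
replace (polar r t - polar s u)%C
  with ((polar r t - polar s t) + (polar s t - polar s u))%C by ring.
eapply Rle_trans; [apply Cmod_triangle|].
rewrite Cmod_polar_minus_radius, Cmod_polar_minus_angle by easy.
apply Rplus_le_compat_l.
generalize (Rabs_sin_le ((t - u) / 2)); unfold Rdiv; rewrite Rabs_mult, (Rabs_pos_eq (/ 2)) by lra.
nra.
Qed.

Definition node (r : R) (N j : nat) : C := polar r (2 * PI * INR j / INR N).

Lemma node_pow_N (r : R) (N j : nat) : (0 < N)%nat -> (node r N j ^ N)%C = RtoC (r ^ N).
Proof.
intros HN; unfold node; rewrite polar_pow.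
replace (INR N * (2 * PI * INR j / INR N)) with (0 + 2 * INR j * PI)
  by (field; apply not_0_INR; lia).
unfold polar; rewrite cos_period, sin_period, cos_0, sin_0.
unfold RtoC; f_equal; ring.
Qed.

Lemma psum_geom (z : C) (N : nat) :
  ((z - 1) * psum (G := C_AbelianMonoid) (fun j => z ^ j)%C N = z ^ N - 1)%C.
Proof.
induction N as [|N IH]; [simpl; change (@zero C_AbelianMonoid) with (RtoC 0); ring|].
simpl; change (@plus C_AbelianMonoid) with Cplus; simpl in IH.
rewrite Cmult_plus_distr_l, IH; ring.
Qed.

(** Orthogonality of roots of unity: up to the factor [r ^ e] this is a geometric sum with ratio
    [z], an [N]-th root of unity different from 1. *)
Lemma node_pow_sum (r : R) (N e : nat) : (0 < e < N)%nat ->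
  psum (G := C_AbelianMonoid) (fun j => node r N j ^ e)%C N = RtoC 0.
Proof.
intros He.
assert (HN : 0 < INR N) by (apply lt_0_INR; lia).
assert (He0 : 0 < INR e) by (apply lt_0_INR; lia).
assert (HeN : INR e < INR N) by (apply lt_INR; lia).
set (z := polar 1 (2 * PI * INR e / INR N)).
rewrite (psum_ext _ (fun j => Cmult (RtoC (r ^ e)) (z ^ j)%C)).
2: { intros j _; unfold node, z; rewrite !polar_pow, pow1.
  replace (INR j * (2 * PI * INR e / INR N)) with (INR e * (2 * PI * INR j / INR N))
    by (field; lra).
  unfold polar, Cmult, RtoC; simpl; f_equal; ring. }
rewrite <- (psum_morph (G := C_AbelianMonoid) (H := C_AbelianMonoid) (Cmult (RtoC (r ^ e)))).
2: apply Cmult_0_r.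
2: intros; apply Cmult_plus_distr_l.
(* The real part of [z] is [1 - 2 sin^2 (PI e / N)], and [0 < e < N] keeps that angle strictly
   between 0 and [PI]. *)
assert (Hz : (z - 1)%C <> 0).
{ intros H0.
  assert (H : 1 * cos (2 * PI * INR e / INR N) = 1).
  { change (fst z = fst (RtoC 1)); f_equal.
    replace z with ((z - 1) + 1)%C by ring; rewrite H0; ring. }
  replace (2 * PI * INR e / INR N) with (2 * (PI * INR e / INR N)) in H by (field; lra).
  rewrite cos_2a_sin in H.
  assert (Hs : 0 < sin (PI * INR e / INR N)).
  { generalize PI_RGT_0; intros HP; apply sin_gt_0.
    - apply Rdiv_lt_0_compat; [nra|easy].
    - apply Rlt_div_l; nra. }
  nra. }
assert (H : (psum (G := C_AbelianMonoid) (fun j => z ^ j)%C N) = RtoC 0).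
{ destruct (Ceq_dec (psum (G := C_AbelianMonoid) (fun j => z ^ j)%C N) (RtoC 0)) as [H|H]; [easy|].
  exfalso; apply (Cmult_neq_0 _ _ Hz H).
  rewrite psum_geom; unfold z.
  rewrite polar_pow, pow1.
  replace (INR N * (2 * PI * INR e / INR N)) with (0 + 2 * INR e * PI) by (field; lra).
  unfold polar; rewrite cos_period, sin_period, cos_0, sin_0.
  unfold Cminus, Cplus, Copp, RtoC; simpl; f_equal; ring. }
eapply eq_trans; [exact (f_equal _ H)|apply Cmult_0_r].
Qed.

(** * Bounded operators and means of vectors *)

Lemma plus_swap {G : AbelianMonoid} (a b c d : G) :
  plus (plus a b) (plus c d) = plus (plus c b) (plus a d).
Proof.
now rewrite plus_assoc, <- (plus_assoc a), (plus_comm a), <- plus_assoc, (plus_comm b).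
Qed.

Lemma plus_minus_cancel {G : AbelianGroup} (x y : G) : plus y (minus x y) = x.
Proof.
unfold minus; rewrite (plus_comm x), plus_assoc, plus_opp_r; apply plus_zero_l.
Qed.

Lemma minus_minus {G : AbelianGroup} (x y : G) : minus x (minus x y) = y.
Proof.
unfold minus at 1; rewrite opp_minus; apply plus_minus_cancel.
Qed.

Lemma minus_minus_minus {G : AbelianGroup} (a b y : G) :
  minus (minus a (minus b y)) y = minus a b.
Proof.
assert (H : plus (plus a (plus y (opp b))) (opp y) = plus a (opp b)).
{ now rewrite <- plus_assoc, (plus_comm y), <- plus_assoc, plus_opp_r, plus_zero_r. }
unfold minus at 1 2; rewrite opp_minus; exact H.
Qed.

Lemma minus_minus_swap {G : AbelianGroup} (a b c : G) :
  minus (minus a b) (minus c b) = minus a c.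
Proof.
assert (H : plus (plus a (opp b)) (plus b (opp c)) = plus a (opp c)).
{ now rewrite plus_swap, plus_opp_r, plus_zero_l. }
unfold minus at 1; rewrite opp_minus; exact H.
Qed.

Lemma minus_eq_iff {G : AbelianGroup} (x y z : G) : minus x y = z <-> y = minus x z.
Proof. split; [intros <- | intros ->]; now rewrite minus_minus. Qed.

Section Bounds.

Context {X : NormedModule C_AbsRing}.

Definition bounded_by (T : X -> X) (M : R) : Prop :=
  forall x, norm (T x) <= M * norm x.

(* Fixing the types keeps all additive operations on the canonical path through
   [NormedModule.AbelianGroup]; a bare [scal] would bring in the one through
   [ModuleSpace], which blocks rewriting. *)
Definition cscal (c : C) (x : X) : X := scal (c : C_AbsRing) x.

Local Notation "c *: x" := (cscal c x) (at level 40).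

Lemma linear_cscal (T : X -> X) (c : C) (x : X) :
  is_linear T -> T (c *: x) = c *: T x.
Proof. intros HT; exact (linear_scal _ HT c x). Qed.

Lemma cscal_opp_one (x : X) : opp x = RtoC (-1) *: x.
Proof.
eapply eq_trans; [symmetry; exact (scal_opp_one (K := C_AbsRing) x)|].
now change (opp (one : C_AbsRing)) with (- RtoC 1)%C; rewrite <- RtoC_opp.
Qed.

Lemma cscal_zero_l (x : X) : RtoC 0 *: x = zero.
Proof. exact (scal_zero_l (K := C_AbsRing) x). Qed.

Lemma cscal_one (x : X) : RtoC 1 *: x = x.
Proof. exact (scal_one (K := C_AbsRing) x). Qed.

Lemma cscal_assoc (a b : C) (x : X) : a *: (b *: x) = (a * b)%C *: x.
Proof. exact (scal_assoc (K := C_AbsRing) a b x). Qed.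

Lemma cscal_plus_l (a b : C) (x : X) : (a + b)%C *: x = plus (a *: x) (b *: x).
Proof. exact (scal_distr_r (K := C_AbsRing) a b x). Qed.

Lemma cscal_minus_l (a b : C) (x : X) : (a - b)%C *: x = minus (a *: x) (b *: x).
Proof. exact (scal_minus_distr_r (K := C_AbsRing) a b x). Qed.

Lemma cscal_minus_r (a : C) (x y : X) : a *: minus x y = minus (a *: x) (a *: y).
Proof. exact (scal_minus_distr_l (K := C_AbsRing) a x y). Qed.

(** The axioms of a normed module give one inequality; the other follows by applying it to the
    inverse scalar. *)
Lemma norm_cscal (c : C) (x : X) : norm (c *: x) = Cmod c * norm x.
Proof.
apply Rle_antisym; [exact (norm_scal (K := C_AbsRing) c x)|].
destruct (Ceq_dec c 0) as [->|Hc].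
- rewrite Cmod_0, Rmult_0_l; apply norm_ge_0.
- assert (Hp : 0 < Cmod c) by now apply Cmod_gt_0.
  replace x with ((/ c)%C *: (c *: x)) at 1.
  2: now rewrite cscal_assoc, Cinv_l, cscal_one.
  generalize (norm_scal (K := C_AbsRing) (/ c)%C (c *: x)).
  change (abs (/ c)%C) with (Cmod (/ c)); rewrite Cmod_inv by easy; intros H.
  apply Rmult_le_compat_l with (r := Cmod c) in H; [|lra].
  rewrite <- Rmult_assoc, Rinv_r, Rmult_1_l in H by lra; exact H.
Qed.

Lemma linear_minus (T : X -> X) (x y : X) :
  is_linear T -> T (minus x y) = minus (T x) (T y).
Proof.
intros HT; unfold minus; rewrite (linear_plus _ HT); f_equal.
now rewrite !cscal_opp_one, (linear_cscal _ _ _ HT).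
Qed.

Lemma linear_zero (T : X -> X) : is_linear T -> T zero = zero.
Proof.
intros HT; rewrite <- (cscal_zero_l zero) at 1.
now rewrite (linear_cscal _ _ _ HT), cscal_zero_l.
Qed.

Lemma op_norm_bounded (T : X -> X) : is_linear T -> bounded_by T (op_norm T).
Proof.
intros HT.
destruct (linear_norm _ HT) as [M [HM HTM]].
assert (Hu : forall x, norm x <= 1 -> norm (T x) <= op_norm T).
{ intros x Hx; unfold op_norm.
  set (E := fun r => _).
  destruct (Lub_Rbar_correct E) as [H1 H2].
  (* Boundedness makes the supremum finite, so [real] does not fall back on its default value. *)
  assert (Hle : Rbar_le (Lub_Rbar E) M).
  { apply H2; intros r [y [Hy ->]]; simpl.
    apply Rle_trans with (1 := HTM y); generalize (norm_ge_0 y); nra. }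
  assert (Hge : Rbar_le (norm (T x)) (Lub_Rbar E)) by (apply H1; now exists x).
  destruct (Lub_Rbar E); simpl in *; easy. }
intros x; destruct (Rle_lt_or_eq_dec 0 (norm x) (norm_ge_0 x)) as [Hx|Hx].
- generalize (Hu (RtoC (/ norm x) *: x)).
  rewrite (linear_cscal _ _ _ HT), !norm_cscal, Cmod_R, Rabs_pos_eq.
  2: now apply Rlt_le, Rinv_0_lt_compat.
  rewrite Rinv_l by lra; intros H; specialize (H (Rle_refl 1)).
  apply Rmult_le_compat_r with (r := norm x) in H; [|lra].
  replace (/ norm x * norm (T x) * norm x) with (norm (T x)) in H by (field; lra).
  easy.
- generalize (HTM x); rewrite <- Hx, !Rmult_0_r; easy.
Qed.

(** The assumption [0 <= M] covers the default value 0 of [real] in the case of [m_infty]. *)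
Lemma op_norm_le (T : X -> X) (M : R) : bounded_by T M -> 0 <= M -> op_norm T <= M.
Proof.
intros HT HM; unfold op_norm; set (E := fun r => _).
destruct (Lub_Rbar_correct E) as [_ H2].
assert (Hle : Rbar_le (Lub_Rbar E) M).
{ apply H2; intros r [y [Hy ->]]; simpl.
  apply Rle_trans with (1 := HT y); generalize (norm_ge_0 y); nra. }
now destruct (Lub_Rbar E); simpl in *.
Qed.

Lemma op_norm_ge_0 (T : X -> X) : 0 <= op_norm T.
Proof.
unfold op_norm; set (E := fun r => _).
destruct (Lub_Rbar_correct E) as [H1 _].
assert (Hge : Rbar_le (norm (T zero)) (Lub_Rbar E)).
{ apply H1; exists zero; split; [|easy].
  rewrite (@norm_zero C_AbsRing); lra. }
generalize (norm_ge_0 (T zero)); destruct (Lub_Rbar E); simpl in *; lra.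
Qed.

Lemma norm_psum (u : nat -> X) (n : nat) : norm (psum u n) <= psum (fun j => norm (u j)) n.
Proof.
induction n as [|n IH]; simpl.
- rewrite (@norm_zero C_AbsRing); apply Rle_refl.
- eapply Rle_trans; [apply norm_triangle|]; now apply Rplus_le_compat_r.
Qed.

Lemma norm_minus_comm (x y : X) : norm (minus x y) = norm (minus y x).
Proof. now rewrite <- (norm_opp (minus x y)), opp_minus. Qed.

Lemma norm_le_minus (x y : X) : norm x <= norm y + norm (minus x y).
Proof. rewrite <- (plus_minus_cancel x y) at 1; apply norm_triangle. Qed.

Definition mean (u : nat -> X) (N : nat) : X := RtoC (/ INR N) *: psum u N.

Lemma mean_ext (u v : nat -> X) (N : nat) :
  (forall j, (j < N)%nat -> u j = v j) -> mean u N = mean v N.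
Proof. intros H; unfold mean; f_equal; now apply psum_ext. Qed.

Lemma mean_minus (u v : nat -> X) (N : nat) :
  mean (fun j => minus (u j) (v j)) N = minus (mean u N) (mean v N).
Proof.
unfold mean; rewrite <- cscal_minus_r; f_equal.
unfold minus; rewrite psum_plus; f_equal; symmetry.
apply (psum_morph (opp : X -> X)); [exact opp_zero|exact opp_plus].
Qed.

Lemma mean_linear (T : X -> X) (u : nat -> X) (N : nat) : is_linear T ->
  T (mean u N) = mean (fun j => T (u j)) N.
Proof.
intros HT; unfold mean; rewrite (linear_cscal _ _ _ HT); f_equal.
apply psum_morph; [now apply linear_zero|apply HT].
Qed.

Lemma mean_scal (c : C) (u : nat -> X) (N : nat) :
  mean (fun j => c *: u j) N = c *: mean u N.
Proof.
symmetry; apply mean_linear.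
apply is_linear_scal_r; intros a b; apply Cmult_comm.
Qed.

(** With a fixed vector the mean reduces to a sum of scalars, to which [node_pow_sum] applies. *)
Lemma mean_scal_vec (c : nat -> C) (x : X) (N : nat) :
  mean (fun j => c j *: x) N = (RtoC (/ INR N) * psum (G := C_AbelianMonoid) c N)%C *: x.
Proof.
unfold mean.
rewrite <- (psum_morph (G := C_AbelianMonoid) (fun c : C => c *: x)).
- apply cscal_assoc.
- apply cscal_zero_l.
- intros a b; apply cscal_plus_l.
Qed.

Lemma mean_const (x : X) (N : nat) : (0 < N)%nat -> mean (fun _ => x) N = x.
Proof.
intros HN; unfold mean.
assert (H : psum (fun _ : nat => x) N = RtoC (INR N) *: x).
{ clear HN; induction N as [|N IH]; simpl psum.
  - symmetry; apply cscal_zero_l.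
  - rewrite IH, S_INR, RtoC_plus.
    now rewrite cscal_plus_l, cscal_one. }
rewrite H, cscal_assoc, <- RtoC_mult, Rinv_l by (apply not_0_INR; lia).
apply cscal_one.
Qed.

Lemma norm_mean (u : nat -> X) (b : nat -> R) (N : nat) :
  (forall j, (j < N)%nat -> norm (u j) <= b j) -> norm (mean u N) <= / INR N * psum b N.
Proof.
intros H; unfold mean; rewrite norm_cscal, Cmod_R.
assert (HN : 0 <= / INR N).
{ destruct N; [simpl; rewrite Rinv_0; lra|].
  apply Rlt_le, Rinv_0_lt_compat, lt_0_INR; lia. }
rewrite Rabs_pos_eq by easy; apply Rmult_le_compat_l; [easy|].
eapply Rle_trans; [apply norm_psum|]; now apply psum_le.
Qed.

Lemma norm_mean_const (u : nat -> X) (b : R) (N : nat) : (0 < N)%nat ->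
  (forall j, (j < N)%nat -> norm (u j) <= b) -> norm (mean u N) <= b.
Proof.
intros HN H; eapply Rle_trans; [now apply (norm_mean u (fun _ => b))|].
rewrite psum_const, <- Rmult_assoc, Rinv_l; [lra|apply not_0_INR; lia].
Qed.

Lemma scalar_minusE (c : C) (T : X -> X) (x : X) :
  scalar_minus c T x = minus (c *: x) (T x).
Proof. reflexivity. Qed.

End Bounds.

Local Notation "c *: x" := (cscal c x) (at level 40).

(** * Resolvents and the discrete Cauchy formula *)

Section Resolvents.

Context {X : NormedModule C_AbsRing}.
Variable T : X -> X.
Hypothesis HT : is_linear T.

Lemma linear_op_pow (m : nat) : is_linear (op_pow T m).
Proof.
induction m as [|m IH]; [apply is_linear_id|].
exact (is_linear_comp (op_pow T m) T IH HT).
Qed.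

Lemma op_pow_succ_r (m : nat) (x : X) : op_pow T (S m) x = op_pow T m (T x).
Proof. apply Nat.iter_succ_r. Qed.

Lemma resolvent_left (l : C) (S : X -> X) (x : X) : is_resolvent l T S ->
  T (S x) = minus (l *: S x) x.
Proof. intros (_ & _ & H); now apply minus_eq_iff, H. Qed.

Lemma resolvent_comm (l : C) (S : X -> X) (x : X) : is_resolvent l T S ->
  S (T x) = T (S x).
Proof.
intros HS; rewrite (resolvent_left _ _ _ HS).
destruct HS as (HSl & H & _).
apply minus_eq_iff.
now rewrite <- (linear_cscal _ _ _ HSl), <- (linear_minus _ _ _ HSl), <- scalar_minusE.
Qed.

(** Write [x] as [(m - T) (U x)], apply [S], and replace [S T] by [l S - I]. *)
Lemma resolvent_identity (l m : C) (S U : X -> X) (x : X) :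
  is_resolvent l T S -> is_resolvent m T U ->
  minus (S x) (U x) = (m - l)%C *: S (U x).
Proof.
intros HS HU.
assert (Hl := proj1 HS).
rewrite <- (proj2 (proj2 HU) x) at 1.
rewrite scalar_minusE, (linear_minus _ _ _ Hl), (linear_cscal _ _ _ Hl).
rewrite (resolvent_comm _ _ _ HS), (resolvent_left _ _ _ HS), cscal_minus_l.
apply minus_minus_minus.
Qed.

(* The resolvent identity bounds [S] in terms of [U] near [m] without a
   Neumann series, since the existence of [S] is given. *)
Lemma resolvent_locally_bounded (l m : C) (S U : X -> X) (M : R) :
  is_resolvent l T S -> is_resolvent m T U -> bounded_by U M ->
  Cmod (m - l) * M <= / 2 -> bounded_by S (2 * M).
Proof.
intros HS HU HM Hd x.
assert (Hc : S (U x) = U (S x)).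
{ rewrite <- (proj1 (proj2 HU) (S (U x))).
  f_equal; rewrite scalar_minusE, <- (resolvent_comm l S), <- (linear_cscal _ _ _ (proj1 HS)),
    <- (linear_minus _ _ _ (proj1 HS)), <- scalar_minusE by easy.
  f_equal; apply HU. }
generalize (norm_le_minus (S x) (U x)).
rewrite (resolvent_identity l m S U x HS HU), norm_cscal, Hc.
generalize (HM x) (HM (S x)) (norm_ge_0 (S x)) (Cmod_ge_0 (m - l)); intros.
assert (Cmod (m - l) * norm (U (S x)) <= / 2 * norm (S x)); [|lra].
apply Rle_trans with (Cmod (m - l) * M * norm (S x)).
- rewrite Rmult_assoc; now apply Rmult_le_compat_l.
- now apply Rmult_le_compat_r.
Qed.

Variable Res : C -> X -> X.
Hypothesis HR : forall l, 1 < Cmod l -> is_resolvent l T (Res l).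

(** Compactness of the rectangle of polar coordinates: each resolvent controls those at nearby
    points, within a distance inverse to its own norm. A uniform lower bound [d] for these distances
    yields a uniform bound for the norms. *)
Lemma resolvent_polar_bounded (r s : R) : 1 < r ->
  exists M, 0 < M /\ forall rho t, r <= rho <= s -> 0 <= t <= 2 * PI ->
    bounded_by (Res (polar rho t)) M.
Proof.
intros Hr.
destruct (Rlt_le_dec s r) as [Hsr|Hrs].
{ exists 1; split; [lra|intros; lra]. }
(* A move by this much in both coordinates shifts the point by at most [1 + s] times as much, which
   gives the factor [/ 2] required by [resolvent_locally_bounded]. The added 1 keeps the denominator
   positive. *)
assert (Hd : forall u v, 0 < / (2 * (1 + s) * (op_norm (Res (polar u v)) + 1))).
{ intros u v; generalize (op_norm_ge_0 (Res (polar u v))); intros.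
  apply Rinv_0_lt_compat; repeat apply Rmult_lt_0_compat; lra. }
destruct (compactness_value_2d r s 0 (2 * PI) (fun u v => mkposreal _ (Hd u v))) as [d H].
assert (Hd0 := cond_pos d).
exists (2 * / (2 * (1 + s) * d)).
assert (HM : 0 < / (2 * (1 + s) * d)).
{ apply Rinv_0_lt_compat; repeat apply Rmult_lt_0_compat; lra. }
split; [lra|]; intros rho t Hrho Ht.
(* [compactness_value_2d] provides its centre [(u, v)] only under a double negation. *)
destruct (NNPP _ (H rho t Hrho Ht)) as (u & v & Hu & Hv & Hu' & Hv' & Hle); clear H.
simpl in Hu', Hv', Hle.
set (m := op_norm (Res (polar u v)) + 1) in *.
assert (Hm : 0 < m) by (generalize (op_norm_ge_0 (Res (polar u v))); unfold m; lra).
assert (Hb : m <= / (2 * (1 + s) * d)).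
{ replace m with (/ (2 * (1 + s) * / (2 * (1 + s) * m))) by (field; lra).
  apply Rinv_le_contravar; [repeat apply Rmult_lt_0_compat; lra|].
  apply Rmult_le_compat_l; lra. }
assert (HRu : is_resolvent (polar u v) T (Res (polar u v))).
{ apply HR; rewrite Cmod_polar; lra. }
assert (HRr : is_resolvent (polar rho t) T (Res (polar rho t))).
{ apply HR; rewrite Cmod_polar; lra. }
intros x; eapply Rle_trans.
- apply (resolvent_locally_bounded _ _ _ _ m HRr HRu).
  + intros y; eapply Rle_trans; [apply op_norm_bounded, HRu|].
    apply Rmult_le_compat_r; [apply norm_ge_0|unfold m; lra].
  + eapply Rle_trans.
    { apply Rmult_le_compat_r; [lra|]; apply Cmod_polar_minus_le; lra. }
    rewrite (Rabs_minus_sym u), (Rabs_minus_sym v).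
    apply Rle_trans with ((1 + s) * / (2 * (1 + s) * m) * m).
    * apply Rmult_le_compat_r; [lra|].
      assert (rho * Rabs (t - v) <= s * / (2 * (1 + s) * m)).
      { apply Rmult_le_compat; [lra|apply Rabs_pos|lra|lra]. }
      lra.
    * right; field; lra.
- apply Rmult_le_compat_r; [apply norm_ge_0|lra].
Qed.

(** The mean [F_r] of the overview: a Riemann sum for the contour integral of the resolvent over
    [2 pi i]. The weight [l] comes from [dl = i l dt]. *)
Definition cauchy (r : R) (N : nat) (x : X) : X :=
  mean (fun j => node r N j *: Res (node r N j) x) N.

Lemma node_resolvent (r : R) (N j : nat) : 1 < r ->
  is_resolvent (node r N j) T (Res (node r N j)).
Proof. intros Hr; apply HR; unfold node; rewrite Cmod_polar; lra. Qed.

Lemma cauchy_comm (r : R) (N : nat) (x : X) : 1 < r ->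
  cauchy r N (T x) = T (cauchy r N x).
Proof.
intros Hr; unfold cauchy; rewrite (mean_linear T) by easy.
apply mean_ext; intros j _.
now rewrite (linear_cscal _ _ _ HT), (resolvent_comm (node r N j)) by now apply node_resolvent.
Qed.

Lemma cauchy_minus (r : R) (N : nat) (x y : X) : 1 < r ->
  cauchy r N (minus x y) = minus (cauchy r N x) (cauchy r N y).
Proof.
intros Hr; unfold cauchy; rewrite <- mean_minus.
apply mean_ext; intros j _.
destruct (node_resolvent r N j Hr) as [Hl _].
now rewrite (linear_minus _ _ _ Hl), cscal_minus_r.
Qed.

Lemma cauchy_scal (r : R) (N : nat) (c : C) (x : X) : 1 < r ->
  cauchy r N (c *: x) = c *: cauchy r N x.
Proof.
intros Hr; unfold cauchy; rewrite <- mean_scal.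
apply mean_ext; intros j _.
destruct (node_resolvent r N j Hr) as [Hl _].
now rewrite (linear_cscal _ _ _ Hl), !cscal_assoc, Cmult_comm.
Qed.

(** Since [T R(l) = l R(l) - I], applying [T] raises the power of the node by one and leaves a mean
    of scalar multiples of [x]. *)
Lemma op_pow_cauchy_step (r : R) (N m : nat) (x : X) : 1 < r ->
  T (mean (fun j => (node r N j ^ m)%C *: Res (node r N j) x) N) =
  minus (mean (fun j => (node r N j ^ S m)%C *: Res (node r N j) x) N)
    (mean (fun j => (node r N j ^ m)%C *: x) N).
Proof.
intros Hr; rewrite mean_linear, <- mean_minus by easy.
apply mean_ext; intros j _.
rewrite (linear_cscal _ _ _ HT), (resolvent_left (node r N j)) by now apply node_resolvent.
now rewrite cscal_minus_r, cscal_assoc, Cpow_S, Cmult_comm.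
Qed.

(** As long as the exponent stays below [N], the correction left by each step vanishes by
    orthogonality. *)
Lemma op_pow_cauchy (r : R) (N m : nat) (x : X) : 1 < r -> (m < N)%nat ->
  op_pow T m (cauchy r N x) = mean (fun j => (node r N j ^ S m)%C *: Res (node r N j) x) N.
Proof.
intros Hr; induction m as [|m IH]; intros Hm.
- apply mean_ext; intros j _; now rewrite Cpow_1_r.
- change (op_pow T (S m) ?y) with (T (op_pow T m y)).
  rewrite IH, op_pow_cauchy_step by (easy || lia).
  rewrite (mean_scal_vec (fun j => node r N j ^ S m)%C), node_pow_sum by lia.
  rewrite Cmult_0_r, cscal_zero_l.
  apply (minus_zero_r (G := NormedModule.AbelianGroup C_AbsRing X)).
Qed.

(** At exponent [N] the powers of the nodes all equal [r ^ N], so the correction no longer vanishes: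
    it is [r ^ N] times [x]. *)
Lemma op_pow_cauchy_N (r : R) (N : nat) (x : X) : 1 < r -> (0 < N)%nat ->
  op_pow T N (cauchy r N x) = RtoC (r ^ N) *: minus (cauchy r N x) x.
Proof.
intros Hr HN; destruct N as [|N]; [lia|].
change (op_pow T (S N) ?y) with (T (op_pow T N y)).
rewrite op_pow_cauchy, op_pow_cauchy_step, cscal_minus_r by (easy || lia).
unfold cauchy; rewrite <- mean_scal; f_equal.
- apply mean_ext; intros j _.
  rewrite cscal_assoc, <- (node_pow_N r (S N) j) by lia.
  now rewrite Cmult_comm, <- Cpow_S.
- rewrite (mean_ext _ (fun _ => RtoC (r ^ S N) *: x)).
  + apply mean_const; lia.
  + intros j _; now rewrite node_pow_N by lia.
Qed.

Definition one_minus_pow (r : R) (N : nat) (x : X) : X :=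
  minus x (RtoC (/ r ^ N) *: op_pow T N x).

(** This is [op_pow_cauchy_N] rearranged, the means commuting with the powers of [T]. *)
Lemma cauchy_one_minus_pow (r : R) (N : nat) (x : X) : 1 < r -> (0 < N)%nat ->
  cauchy r N (one_minus_pow r N x) = x.
Proof.
intros Hr HN; unfold one_minus_pow.
rewrite cauchy_minus, cauchy_scal by easy.
assert (Hc : forall m y, cauchy r N (op_pow T m y) = op_pow T m (cauchy r N y)).
{ induction m as [|m IH]; intros y; [easy|].
  now rewrite !op_pow_succ_r, IH, cauchy_comm. }
rewrite Hc, op_pow_cauchy_N, cscal_assoc, <- RtoC_mult, Rinv_l, cscal_one by
  (easy || apply pow_nonzero; lra).
exact (minus_minus (cauchy r N x) x).
Qed.

Lemma cauchy_formula (r : R) (N n k : nat) (x : X) : 1 < r -> (n + k < N)%nat ->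
  op_pow T n (op_pow (scalar_minus 1 T) k x) =
  mean (fun j => (node r N j ^ S n * (1 - node r N j) ^ k)%C *:
                 Res (node r N j) (one_minus_pow r N x)) N.
Proof.
intros Hr Hnk.
(* Once [x] is written as a mean, the powers of [T] become powers of the nodes. Each factor [I - T]
   is a difference of two consecutive powers, hence a factor [1 - l]; so [n] must vary in the
   induction on [k]. *)
rewrite <- (cauchy_one_minus_pow r N x) at 1 by (easy || lia).
generalize (one_minus_pow r N x); clear x; intros x.
revert n Hnk; induction k as [|k IH]; intros n Hnk.
- simpl; rewrite op_pow_cauchy by (easy || lia).
  apply mean_ext; intros j _; now rewrite Cmult_1_r.
- change (op_pow (scalar_minus 1 T) (S k) ?y)
    with (scalar_minus 1 T (op_pow (scalar_minus 1 T) k y)).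
  rewrite scalar_minusE, (linear_minus _ _ _ (linear_op_pow n)), cscal_one.
  rewrite <- op_pow_succ_r, !IH, <- mean_minus by lia.
  apply mean_ext; intros j _; rewrite <- cscal_minus_l; f_equal.
  rewrite !Cpow_S; ring.
Qed.

(** * Domination of the powers of T on every circle outside the unit disk *)

Definition pow_dominated (r : R) : Prop :=
  exists N0, forall N, (N0 <= N)%nat -> bounded_by (op_pow T N) (r ^ N).

(** Put [y = (I - T^N / r^N) x], so that the mean sends [y] to [x]. Then
    [norm (x - y) <= norm y / 2] forces [norm y <= 2 norm x], hence [norm (x - y) <= norm x], and
    [x - y] is [T^N x / r^N]. *)
Lemma pow_dominated_of_cauchy_near_id (r : R) (N : nat) : 1 < r -> (0 < N)%nat ->
  (forall x, norm (minus (cauchy r N x) x) <= / 2 * norm x) ->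
  bounded_by (op_pow T N) (r ^ N).
Proof.
intros Hr HN H x.
assert (HrN : 0 < r ^ N) by (apply pow_lt; lra).
set (y := one_minus_pow r N x).
generalize (H y); unfold y; rewrite cauchy_one_minus_pow by easy; fold y; intros Hy.
generalize (norm_le_minus y x); rewrite norm_minus_comm; intros Hyx.
assert (Hz : minus x y = RtoC (/ r ^ N) *: op_pow T N x) by exact (minus_minus x _).
rewrite Hz, norm_cscal, Cmod_R, Rabs_pos_eq in Hy, Hyx
  by now apply Rlt_le, Rinv_0_lt_compat.
assert (H1 : / r ^ N * norm (op_pow T N x) <= norm x) by lra.
apply Rmult_le_compat_l with (r := r ^ N) in H1; [|lra].
now rewrite <- Rmult_assoc, Rinv_r, Rmult_1_l in H1 by lra.
Qed.

(** By [op_pow_cauchy_N], the mean minus the identity is [T^N / r^N] applied to the mean. *)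
Lemma cauchy_near_id_of_pow_bounded (r q M : R) (N : nat) : 1 < r -> (0 < N)%nat ->
  0 <= q -> bounded_by (op_pow T N) (q * r ^ N) -> bounded_by (cauchy r N) M ->
  bounded_by (fun x => minus (cauchy r N x) x) (q * M).
Proof.
intros Hr HN Hq Hp HM x.
assert (HrN : 0 < r ^ N) by (apply pow_lt; lra).
generalize (Hp (cauchy r N x)); rewrite op_pow_cauchy_N by easy.
rewrite norm_cscal, Cmod_R, Rabs_pos_eq by lra; intros H.
apply Rmult_le_reg_l with (r ^ N); [easy|].
apply Rle_trans with (1 := H).
replace (r ^ N * (q * M * norm x)) with (q * r ^ N * (M * norm x)) by ring.
apply Rmult_le_compat_l; [nra|apply HM].
Qed.

Lemma op_pow_bounded (M : R) (N : nat) : 0 <= M -> bounded_by T M ->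
  bounded_by (op_pow T N) (M ^ N).
Proof.
intros HM0 HM; induction N as [|N IH]; intros x.
- simpl; rewrite Rmult_1_l; apply Rle_refl.
- eapply Rle_trans; [exact (HM (op_pow T N x))|].
  simpl; rewrite Rmult_assoc; apply Rmult_le_compat_l; [easy|apply IH].
Qed.

Lemma node_angle (N j : nat) : (j < N)%nat -> 0 <= 2 * PI * INR j / INR N <= 2 * PI.
Proof.
intros Hj.
assert (HN : 0 < INR N) by (apply lt_0_INR; lia).
assert (HjN : INR j <= INR N) by (apply le_INR; lia).
assert (HP := PI_RGT_0); assert (Hj0 := pos_INR j).
split; [apply Rdiv_le_0_compat; nra|apply Rle_div_l; nra].
Qed.

Section Annulus.

Variables r s M : R.
Hypothesis Hr : 1 < r.
Hypothesis Hrs : r <= s.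
Hypothesis HM0 : 0 < M.
Hypothesis HM : forall rho t, r <= rho <= s -> 0 <= t <= 2 * PI ->
  bounded_by (Res (polar rho t)) M.

Lemma cauchy_bounded (rho : R) (N : nat) : r <= rho <= s -> (0 < N)%nat ->
  bounded_by (cauchy rho N) (s * M).
Proof.
intros Hrho HN x; apply norm_mean_const; [easy|intros j Hj].
rewrite norm_cscal; unfold node; rewrite Cmod_polar, (Rmult_assoc s) by lra.
apply Rmult_le_compat; [lra|apply norm_ge_0|lra|].
apply HM; [easy|now apply node_angle].
Qed.

Lemma cauchy_lipschitz (rho sigma : R) (N : nat) (x : X) :
  r <= rho <= s -> r <= sigma <= s -> (0 < N)%nat ->
  norm (minus (cauchy rho N x) (cauchy sigma N x)) <=
  (M + s * M ^ 2) * Rabs (rho - sigma) * norm x.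
Proof.
intros Hrho Hsigma HN; unfold cauchy; rewrite <- mean_minus.
apply norm_mean_const; [easy|intros j Hj].
set (l := node rho N j); set (m := node sigma N j).
assert (Hlm : Cmod (l - m) = Rabs (rho - sigma)) by apply Cmod_polar_minus_radius.
assert (Hml : Cmod (m - l) = Rabs (rho - sigma)).
{ rewrite <- Hlm, <- Cmod_opp; f_equal; ring. }
assert (Hl : is_resolvent l T (Res l)) by (apply node_resolvent; lra).
assert (Hm : is_resolvent m T (Res m)) by (apply node_resolvent; lra).
assert (Hbl : bounded_by (Res l) M) by now apply HM, node_angle.
assert (Hbm : bounded_by (Res m) M) by now apply HM, node_angle.
assert (Hmm : Cmod m = sigma) by (apply Cmod_polar; lra).
(* Split [l R(l) - m R(m)] as [m (R(l) - R(m)) + (l - m) R(l)]; the resolvent identity handles the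
   first term. Nodes of equal index lie on one ray, so the constant is independent of [N]. *)
rewrite <- (plus_minus_cancel (minus (l *: Res l x) (m *: Res m x))
  (m *: minus (Res l x) (Res m x))).
rewrite (resolvent_identity l m _ _ x Hl Hm) at 1.
eapply Rle_trans; [apply norm_triangle|].
replace (minus (minus (l *: Res l x) (m *: Res m x)) (m *: minus (Res l x) (Res m x)))
  with ((l - m)%C *: Res l x).
2: { rewrite cscal_minus_l, cscal_minus_r.
  symmetry; exact (minus_minus_swap _ _ _). }
rewrite !norm_cscal, Hmm, Hlm, Hml.
generalize (Hbl x) (Hbm x) (Hbl (Res m x)) (norm_ge_0 x) (Rabs_pos (rho - sigma)).
generalize (norm_ge_0 (Res l (Res m x))).
set (a := norm (Res l (Res m x))); set (b := norm (Res l x)); set (c := norm (Res m x)).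
set (d := Rabs (rho - sigma)); intros Ha H1 H2 H3 Hx Hd.
assert (Ha' : a <= M * M * norm x).
{ apply Rle_trans with (1 := H3); rewrite Rmult_assoc; apply Rmult_le_compat_l; lra. }
assert (sigma * (d * a) <= s * (d * (M * M * norm x))).
{ apply Rmult_le_compat; [lra|nra|lra|now apply Rmult_le_compat_l]. }
assert (d * b <= d * (M * norm x)) by now apply Rmult_le_compat_l.
lra.
Qed.

(** Domination at [rho] makes [T^N] geometrically small relative to [(rho + e)^N], so the mean on
    the larger circle is within [/ 4] of the identity. The Lipschitz bound carries this inwards to
    [sigma] at a cost of another [/ 4]. *)
Lemma pow_dominated_step (rho sigma : R) :
  r <= sigma <= rho -> rho + / (8 * (M + s * M ^ 2)) <= s ->
  rho - sigma <= / (8 * (M + s * M ^ 2)) -> pow_dominated rho -> pow_dominated sigma.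
Proof.
intros Hsigma Hrho Hstep [N0 HN0].
set (L := M + s * M ^ 2) in *.
assert (HL : 0 < L) by (unfold L; nra).
(* The distance from [rho + e] to [sigma] is at most [2 e], and [L * (2 * e) = / 4]. *)
set (e := / (8 * L)) in *.
assert (He : 0 < e) by (apply Rinv_0_lt_compat; lra).
assert (HLe : L * e = / 8) by (unfold e; field; lra).
assert (Hq : 0 < rho / (rho + e) < 1).
{ split; [apply Rdiv_lt_0_compat; lra|apply Rlt_div_l; lra]. }
destruct (pow_lt_1_zero (rho / (rho + e)) ltac:(rewrite Rabs_pos_eq; lra)
            (/ (4 * (s * M)))) as [N1 HN1].
{ apply Rinv_0_lt_compat; nra. }
exists (S (Nat.max N0 N1)); intros N HN.
apply pow_dominated_of_cauchy_near_id; [lra|lia|intros x].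
rewrite <- (plus_minus_cancel (minus (cauchy sigma N x) x) (minus (cauchy (rho + e) N x) x)).
eapply Rle_trans; [apply norm_triangle|].
assert (Hswap : minus (minus (cauchy sigma N x) x) (minus (cauchy (rho + e) N x) x) =
  minus (cauchy sigma N x) (cauchy (rho + e) N x)) by exact (minus_minus_swap _ _ _).
rewrite Hswap; clear Hswap.
assert (H1 : norm (minus (cauchy (rho + e) N x) x) <= / 4 * norm x).
{ eapply Rle_trans.
  - apply (cauchy_near_id_of_pow_bounded (rho + e) ((rho / (rho + e)) ^ N) (s * M));
      [lra|lia|apply pow_le; lra| |apply cauchy_bounded; [lra|lia]].
    unfold Rdiv; rewrite Rpow_mult_distr, pow_inv, Rmult_assoc, Rinv_l, Rmult_1_r
      by (apply pow_nonzero; lra).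
    apply HN0; lia.
  - apply Rmult_le_compat_r; [apply norm_ge_0|].
    assert (H := HN1 N ltac:(lia)); rewrite Rabs_pos_eq in H by (apply pow_le; lra).
    replace (/ 4) with (/ (4 * (s * M)) * (s * M)) by (field; nra).
    apply Rmult_le_compat_r; [nra|lra]. }
assert (H2 : norm (minus (cauchy sigma N x) (cauchy (rho + e) N x)) <= / 4 * norm x).
{ eapply Rle_trans; [apply cauchy_lipschitz; [lra|lra|lia]|].
  apply Rmult_le_compat_r; [apply norm_ge_0|].
  fold L; rewrite Rabs_left1 by lra.
  apply Rle_trans with (L * (2 * e)); [apply Rmult_le_compat_l; lra|lra]. }
lra.
Qed.

End Annulus.

Lemma pow_dominated_gt_1 (r : R) : 1 < r -> pow_dominated r.
Proof.
intros Hr.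
destruct (linear_norm _ HT) as [M0 [HM0 HTM]].
set (s := M0 + r).
destruct (resolvent_polar_bounded r (s + 1) Hr) as [M [HM HMb]].
assert (Hs : pow_dominated s).
{ exists 0%nat; intros N _; apply op_pow_bounded; [unfold s; lra|].
  intros x; eapply Rle_trans; [apply HTM|].
  apply Rmult_le_compat_r; [apply norm_ge_0|unfold s; lra]. }
(* With [M'] at least 1 the step is at most 1, so the circles stay within [s + 1]. *)
set (M' := M + 1).
assert (HMb' : forall rho t, r <= rho <= s + 1 -> 0 <= t <= 2 * PI ->
  bounded_by (Res (polar rho t)) M').
{ intros rho t H1 H2 x; eapply Rle_trans; [now apply HMb|].
  apply Rmult_le_compat_r; [apply norm_ge_0|unfold M'; lra]. }
set (e := / (8 * (M' + (s + 1) * M' ^ 2))).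
assert (HM' : 1 <= M') by (unfold M'; lra).
assert (He : 0 < e <= 1).
{ unfold e; split; [apply Rinv_0_lt_compat; unfold s; nra|].
  rewrite <- Rinv_1; apply Rinv_le_contravar; [lra|unfold s; nra]. }
(* Descend from [s] in steps of the fixed length [e]; [Rmax] stops the descent at [r]. *)
assert (Hi : forall i, pow_dominated (Rmax r (s - INR i * e))).
{ induction i as [|i IH].
  - simpl; rewrite Rmult_0_l, Rminus_0_r, Rmax_right; [easy|unfold s; lra].
  - rewrite S_INR.
    assert (Hie : 0 <= INR i * e) by (apply Rmult_le_pos; [apply pos_INR|lra]).
    assert (Hrs : r <= s) by (unfold s; lra).
    assert (Hstep : forall u, Rmax r (u - e) <= Rmax r u <= Rmax r (u - e) + e).
    { intros u; unfold Rmax; destruct (Rle_dec r u), (Rle_dec r (u - e)); lra. }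
    specialize (Hstep (s - INR i * e)).
    replace (s - INR i * e - e) with (s - (INR i + 1) * e) in Hstep by ring.
    apply (pow_dominated_step r (s + 1) M') with (rho := Rmax r (s - INR i * e));
      try easy; fold e; try lra.
    + split; [apply Rmax_l|easy].
    + assert (Rmax r (s - INR i * e) <= s); [apply Rmax_lub|]; lra. }
destruct (nfloor_ex ((s - r) / e)) as [i [_ Hie]].
{ apply Rdiv_le_0_compat; unfold s; lra. }
specialize (Hi (S i)); rewrite S_INR, Rmax_left in Hi; [easy|].
apply Rlt_div_l in Hie; lra.
Qed.

End Resolvents.

(** * Distances of the nodes to 1 *)

Lemma Cmod_minus_comm (a b : C) : Cmod (a - b) = Cmod (b - a).
Proof. rewrite <- Cmod_opp; f_equal; ring. Qed.

Lemma Cmod_polar_minus_1_ge_radius (r t : R) : 1 <= r ->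
  r - 1 <= Cmod (polar r t - 1).
Proof.
intros Hr.
generalize (Cmod_triangle (polar r t - 1) 1).
replace (polar r t - 1 + 1)%C with (polar r t) by ring.
rewrite Cmod_1, Cmod_polar; lra.
Qed.

(** The squared distance is [(r - 1)^2 + 4 r sin^2 (t / 2)], and [r >= 1]. *)
Lemma Cmod_polar_minus_1_ge_angle (r t : R) : 1 <= r ->
  2 * Rabs (sin (t / 2)) <= Cmod (polar r t - 1).
Proof.
intros Hr.
apply Rsqr_incr_0_var; [|apply Cmod_ge_0].
rewrite Rsqr_mult, <- Rsqr_abs, !Rsqr_pow2, Cmod2_alt.
unfold polar; simpl Re; simpl Im.
assert (H : cos t = 1 - 2 * (sin (t / 2) * sin (t / 2))).
{ replace t with (2 * (t / 2)) at 1 by field; rewrite cos_2a_sin; ring. }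
generalize (sin2_cos2 t); unfold Rsqr; intros H1.
replace ((r * cos t + - (1)) ^ 2 + (r * sin t + - 0) ^ 2)
  with (r * r * (sin t * sin t + cos t * cos t) - 2 * r * cos t + 1) by ring.
rewrite H1, H.
assert (0 <= sin (t / 2) * sin (t / 2)) by apply Rle_0_sqr.
nra.
Qed.

Lemma sin_PI_ge (x : R) : 0 <= x <= / 2 -> x <= sin (PI * x).
Proof.
intros Hx.
assert (H1 := PI_4); assert (H2 := PI2_3_2).
assert (Hy : 0 <= PI * x <= 2) by nra.
(* On [[0, 2]] the cubic Taylor bound gives [sin y >= y - y^3 / 6 >= y / 3]; then [PI >= 3]
   suffices. *)
assert (H : PI * x / 3 <= sin (PI * x)); [|nra].
revert Hy; generalize (PI * x); intros y Hy.
destruct (pre_sin_bound y 0) as [H _]; [lra|lra|].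
eapply Rle_trans; [|exact H].
unfold sin_approx, sin_term; simpl.
replace (1 * (y * 1 / 1) + -1 * 1 * (y * (y * (y * 1)) / (1 + 1 + 1 + 1 + 1 + 1)))
  with (y - y * (y * y) / 6) by field.
nra.
Qed.

Lemma node_minus_1_ge (r : R) (N j : nat) : 1 <= r -> (j < N)%nat ->
  2 * Rmin (INR j / INR N) (1 - INR j / INR N) <= Cmod (node r N j - 1).
Proof.
intros Hr Hj.
assert (HN : 0 < INR N) by (apply lt_0_INR; lia).
assert (HjN : INR j < INR N) by (apply lt_INR; lia).
assert (Hj0 := pos_INR j).
eapply Rle_trans; [|apply Cmod_polar_minus_1_ge_angle; easy].
apply Rmult_le_compat_l; [lra|].
eapply Rle_trans; [|apply Rle_abs].
replace (2 * PI * INR j / INR N / 2) with (PI * (INR j / INR N)) by (field; lra).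
assert (Hx : 0 <= INR j / INR N < 1).
{ split; [apply Rdiv_le_0_compat; lra|apply Rlt_div_l; lra]. }
revert Hx; generalize (INR j / INR N); intros x Hx.
destruct (Rle_lt_dec x (/ 2)).
- eapply Rle_trans; [apply Rmin_l|apply sin_PI_ge; lra].
- eapply Rle_trans; [apply Rmin_r|].
  rewrite <- sin_PI_x; replace (PI - PI * x) with (PI * (1 - x)) by ring.
  apply sin_PI_ge; lra.
Qed.

(* The N = n L nodes are cut into n arcs of L nodes; on the m-th arc the distance
   to 1 is at least of order min (m + 1, n - m) / n, the radius taking care of the
   arcs next to 1. *)
Lemma node_minus_1_ge_block (n L j : nat) : (0 < n)%nat -> (0 < L)%nat -> (j < n * L)%nat ->
  let d := Cmod (node (1 + / (2 * INR n)) (n * L) j - 1) in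
  INR (S (j / L)) / (2 * INR n) <= d \/ INR (n - j / L) / (2 * INR n) <= d.
Proof.
intros Hn HL Hj d.
assert (Hn0 : 0 < INR n) by now apply lt_0_INR.
assert (HL0 : 0 < INR L) by now apply lt_0_INR.
assert (He : 0 < / (2 * INR n)) by (apply Rinv_0_lt_compat; lra).
assert (Hd1 : / (2 * INR n) <= d).
{ generalize (Cmod_polar_minus_1_ge_radius (1 + / (2 * INR n))
    (2 * PI * INR j / INR (n * L))); unfold d, node; lra. }
assert (Hd2 : 2 * Rmin (INR j / INR (n * L)) (1 - INR j / INR (n * L)) <= d).
{ apply node_minus_1_ge; [lra|easy]. }
assert (Hm : (j / L < n)%nat) by (apply Nat.Div0.div_lt_upper_bound; lia).
assert (Hm1 : (L * (j / L) <= j)%nat) by apply Nat.Div0.mul_div_le.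
assert (Hm2 : (j < L * S (j / L))%nat) by (apply Nat.mul_succ_div_gt; lia).
revert Hm Hm1 Hm2; generalize (j / L)%nat; intros m Hm Hm1 Hm2.
apply le_INR in Hm1; apply lt_INR in Hm2; rewrite mult_INR in Hm1, Hm2.
assert (Hx1 : INR m / INR n <= INR j / INR (n * L)).
{ rewrite mult_INR; apply Rle_div_l; [lra|].
  replace (INR j / (INR n * INR L) * INR n) with (INR j / INR L) by (field; lra).
  apply Rle_div_r; lra. }
assert (Hx2 : INR j / INR (n * L) <= INR (S m) / INR n).
{ rewrite mult_INR; apply -> Rle_div_r; [|lra].
  replace (INR j / (INR n * INR L) * INR n) with (INR j / INR L) by (field; lra).
  apply Rle_div_l; lra. }
assert (Hq : forall q, INR q / INR n <= d / 2 -> INR (S q) / (2 * INR n) <= d).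
{ intros [|q] H; [simpl; unfold Rdiv; lra|].
  apply <- Rle_div_l; [|lra]; apply -> Rle_div_l in H; [|lra].
  rewrite (S_INR (S q)); assert (1 <= INR (S q)) by (apply (le_INR 1); lia); nra. }
unfold Rmin in Hd2; destruct (Rle_dec _ _) in Hd2.
- left; apply Hq; lra.
(* Measured from the other side, the far end of arc [m] is at the fraction [1 - (m + 1) / n], whence
   the shift by one. *)
- right; replace (n - m)%nat with (S (n - S m)) by lia; apply Hq.
  rewrite minus_INR by lia.
  replace ((INR n - INR (S m)) / INR n) with (1 - INR (S m) / INR n) by (field; lra).
  lra.
Qed.

Lemma Rpower_neg_antitone (a b c : R) : 0 <= c -> 0 < a <= b ->
  Rpower b (- c) <= Rpower a (- c).
Proof.
intros Hc Hab; rewrite !Rpower_Ropp.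
apply Rinv_le_contravar; [apply exp_pos|now apply Rle_Rpower_l].
Qed.

(** Each arc is bounded by the sum of the two alternatives of [node_minus_1_ge_block]. Reversing the
    order of the arcs makes the two resulting sums equal, which gives the factor 2. The bound does
    not depend on [L]. *)
Lemma mean_node_dist_Rpower_le (gamma : R) (n L : nat) :
  0 <= gamma -> (0 < n)%nat -> (0 < L)%nat ->
  / INR (n * L) * psum (fun j =>
    Rpower (Cmod (node (1 + / (2 * INR n)) (n * L) j - 1)) (- gamma)) (n * L) <=
  2 * Rpower 2 gamma * Rpower (INR n) (gamma - 1) *
  psum (fun m => Rpower (INR (S m)) (- gamma)) n.
Proof.
intros Hg Hn HL.
assert (Hn0 : 0 < INR n) by now apply lt_0_INR.
assert (HL0 : 0 < INR L) by now apply lt_0_INR.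
set (f := fun q : nat => Rpower (INR q / (2 * INR n)) (- gamma)).
apply Rle_trans with (/ INR (n * L) *
  psum (fun j => f (S (j / L)) + f (n - j / L)%nat) (n * L)).
{ apply Rmult_le_compat_l.
  - apply Rlt_le, Rinv_0_lt_compat, lt_0_INR; nia.
  - apply psum_le; intros j Hj.
    assert (Hf : forall q, 0 < f q) by (intros; apply exp_pos).
    assert (Hm : (j / L < n)%nat) by (apply Nat.Div0.div_lt_upper_bound; lia).
    assert (Hp : forall q, (0 < q)%nat -> 0 < INR q / (2 * INR n)).
    { intros q Hq; apply Rdiv_lt_0_compat; [now apply lt_0_INR|lra]. }
    destruct (node_minus_1_ge_block n L j Hn HL Hj) as [H|H].
    + apply Rle_trans with (f (S (j / L))).
      * apply Rpower_neg_antitone; [easy|split; [apply Hp; lia|easy]].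
      * generalize (Hf (n - j / L)%nat); lra.
    + apply Rle_trans with (f (n - j / L)%nat).
      * apply Rpower_neg_antitone; [easy|split; [apply Hp; lia|easy]].
      * generalize (Hf (S (j / L))); lra. }
rewrite (psum_block (fun m => f (S m) + f (n - m)%nat) n L HL).
assert (Hs := psum_plus (G := R_AbelianMonoid) (fun m => f (S m)) (fun m => f (n - m)%nat) n).
change (@plus R_AbelianMonoid) with Rplus in Hs; rewrite Hs, psum_rev; clear Hs.
change (@plus R_AbelianMonoid) with Rplus.
assert (Hf : psum (fun m => f (S m)) n =
  Rpower 2 gamma * Rpower (INR n) gamma * psum (fun m => Rpower (INR (S m)) (- gamma)) n).
{ rewrite <- psum_mult_l; apply psum_ext; intros m _; unfold f.
  assert (Hm : 0 < INR (S m)) by (apply lt_0_INR; lia).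
  rewrite !Rpower_mult_distr by lra; unfold Rdiv.
  rewrite <- Rpower_mult_distr by (try easy; apply Rinv_0_lt_compat; lra).
  rewrite Rmult_comm; f_equal.
  unfold Rpower; f_equal; rewrite ln_Rinv by lra; ring. }
rewrite Hf, mult_INR.
unfold Rminus; rewrite Rpower_plus, Rpower_Ropp, Rpower_1 by easy.
right; field; lra.
Qed.

(** * Sums of negative powers by comparison with integrals *)

Lemma psum_le_primitive (f F : R -> R) (n : nat) :
  (forall x, 1 <= x -> derivable_pt_lim F x (f x)) ->
  (forall x y, 1 <= x <= y -> f y <= f x) ->
  psum (fun m => f (INR (S m))) (S n) <= f 1 + F (INR (S n)) - F 1.
Proof.
intros HF Hf; induction n as [|n IH].
- simpl; change (@zero R_AbelianMonoid) with 0; change (0 + f 1 <= f 1 + F 1 - F 1); lra.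
- change (psum (fun m => f (INR (S m))) (S (S n)))
    with (psum (fun m => f (INR (S m))) (S n) + f (INR (S (S n)))).
  assert (Hn : 1 <= INR (S n)) by (apply (le_INR 1); lia).
  destruct (MVT_cor2 F f (INR (S n)) (INR (S (S n)))) as [c [Hc1 Hc2]].
  + apply lt_INR; lia.
  + intros c Hc; apply HF; lra.
  (* The mean value theorem bounds the new term by the increment of [F]; the term [f 1] was set
     aside. *)
  + assert (Hfc := Hf c (INR (S (S n))) ltac:(lra)).
    rewrite (S_INR (S n)) in *; nra.
Qed.

Lemma derivable_pt_lim_Rpower_primitive (gamma x : R) : gamma <> 1 -> 0 < x ->
  derivable_pt_lim (fun y => / (1 - gamma) * Rpower y (1 - gamma)) x (Rpower x (- gamma)).
Proof.
intros Hg Hx.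
replace (Rpower x (- gamma)) with (/ (1 - gamma) * ((1 - gamma) * Rpower x (1 - gamma - 1))).
- apply (derivable_pt_lim_scal (fun y => Rpower y (1 - gamma))).
  now apply derivable_pt_lim_power.
- replace (1 - gamma - 1) with (- gamma) by ring; field; lra.
Qed.

Lemma Rpower_1_l (c : R) : Rpower 1 c = 1.
Proof. unfold Rpower; rewrite ln_1, Rmult_0_r; apply exp_0. Qed.

Lemma psum_Rpower_gt_1 (gamma : R) (n : nat) : 1 < gamma ->
  psum (fun m => Rpower (INR (S m)) (- gamma)) n <= 1 + / (gamma - 1).
Proof.
intros Hg.
assert (Hi : 0 < / (gamma - 1)) by (apply Rinv_0_lt_compat; lra).
destruct n as [|n]; [simpl; change (0 <= 1 + / (gamma - 1)); lra|].
eapply Rle_trans.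
- apply (psum_le_primitive (fun x => Rpower x (- gamma))
    (fun y => / (1 - gamma) * Rpower y (1 - gamma))).
  + intros; apply derivable_pt_lim_Rpower_primitive; lra.
  + intros; apply Rpower_neg_antitone; lra.
- rewrite !Rpower_1_l.
  replace (/ (1 - gamma)) with (- / (gamma - 1)) by (field; lra).
  assert (0 < Rpower (INR (S n)) (1 - gamma)) by apply exp_pos.
  nra.
Qed.

Lemma psum_Rpower_lt_1 (gamma : R) (n : nat) : 0 <= gamma < 1 -> (0 < n)%nat ->
  psum (fun m => Rpower (INR (S m)) (- gamma)) n <=
  (1 + / (1 - gamma)) * Rpower (INR n) (1 - gamma).
Proof.
intros Hg Hn.
assert (Hi : 0 < / (1 - gamma)) by (apply Rinv_0_lt_compat; lra).
destruct n as [|n]; [lia|].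
eapply Rle_trans.
- apply (psum_le_primitive (fun x => Rpower x (- gamma))
    (fun y => / (1 - gamma) * Rpower y (1 - gamma))).
  + intros; apply derivable_pt_lim_Rpower_primitive; lra.
  + intros; apply Rpower_neg_antitone; lra.
- rewrite !Rpower_1_l.
  (* The leading term 1 is absorbed into [n^(1 - gamma)]. *)
  assert (Rpower 1 (1 - gamma) <= Rpower (INR (S n)) (1 - gamma)).
  { apply Rle_Rpower_l; [lra|split; [lra|apply (le_INR 1); lia]]. }
  rewrite Rpower_1_l in *; lra.
Qed.

Lemma psum_harmonic (n : nat) : (0 < n)%nat ->
  psum (fun m => / INR (S m)) n <= 3 * ln (INR n + 1).
Proof.
intros Hn; destruct n as [|n]; [lia|].
assert (Hn1 : 1 <= INR (S n)) by (apply (le_INR 1); lia).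
eapply Rle_trans.
- apply (psum_le_primitive Rinv ln).
  + intros x Hx; apply derivable_pt_lim_ln; lra.
  + intros; apply Rinv_le_contravar; lra.
- rewrite Rinv_1, ln_1.
  (* The constant 3 comes from [1 + ln n], where [1 <= 2 ln 2 <= 2 ln (n + 1)]. *)
  assert (H1 : ln (INR (S n)) <= ln (INR (S n) + 1)) by (apply ln_le; lra).
  assert (H2 : ln 2 <= ln (INR (S n) + 1)) by (apply ln_le; lra).
  assert (H3 := ln_lt_2); lra.
Qed.

(** * The power bound *)

(** From [1 + x <= exp x] and [(n + 1) / (2 n) <= 1]. On the chosen circle it keeps the factor
    [l^(n+1)] bounded. *)
Lemma pow_one_plus_half_inv_le (n : nat) : (0 < n)%nat ->
  (1 + / (2 * INR n)) ^ S n <= exp 1.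
Proof.
intros Hn.
assert (Hn1 : 1 <= INR n) by (apply (le_INR 1); lia).
assert (He : 0 < / (2 * INR n)) by (apply Rinv_0_lt_compat; lra).
apply Rle_trans with (exp (/ (2 * INR n)) ^ S n).
- apply pow_incr; split; [lra|apply exp_ineq1_le].
- rewrite <- Rpower_pow by apply exp_pos.
  unfold Rpower; rewrite ln_exp, S_INR.
  assert (H : (INR n + 1) * / (2 * INR n) <= 1).
  { apply <- Rle_div_l; lra. }
  destruct H as [H|H]; [left; now apply exp_increasing|right; now rewrite H].
Qed.

Lemma resolvent_family {X : NormedModule C_AbsRing} (T : X -> X) :
  (forall l : C, spectrum T l -> Cmod l <= 1) ->
  exists Res : C -> X -> X, forall l, 1 < Cmod l -> is_resolvent l T (Res l).
Proof.
intros H.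
assert (Hex : forall l : C, exists S : X -> X, 1 < Cmod l -> is_resolvent l T S).
{ intros l; destruct (classic (exists S : X -> X, is_resolvent l T S)) as [[S HS]|HS].
  - now exists S.
  - exists (fun x => x); intros Hl; generalize (H l HS); lra. }
exists (fun l => proj1_sig (constructive_indefinite_description _ (Hex l))).
intros l; exact (proj2_sig (constructive_indefinite_description _ (Hex l))).
Qed.

(** The common source of all cases of the theorem, which differ only in the growth of the last sum.
    The condition [INR k <= alpha] makes the weight decrease with the distance to 1, so lower bounds
    for that distance suffice. *)
Lemma RK_operator_power_bound {X : NormedModule C_AbsRing} (T : X -> X)
    (alpha beta : R) (k : nat) : 0 <= beta -> INR k <= alpha -> RK_operator alpha beta T ->
  exists K, 0 < K /\ forall n, (1 <= n)%nat ->
    op_norm (fun x => op_pow T n (op_pow (scalar_minus 1 T) k x)) <=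
    K * Rpower (INR n) (alpha + beta - INR k - 1) *
    psum (fun m => Rpower (INR (S m)) (- (alpha - INR k))) n.
Proof.
intros Hbeta Hk (HT & Hsp & K & HK & HRK).
destruct (resolvent_family T Hsp) as [Res HR].
set (gamma := alpha - INR k).
(* The 4 combines [norm y <= 2 * norm x] with the two sides of the circle; [exp 1] bounds [r^(n+1)];
   the powers of 2 come from [r - 1 = / (2 n)] and from the distance bound for the arcs. *)
exists (4 * exp 1 * K * Rpower 2 beta * Rpower 2 gamma).
assert (Hpos : forall x y, 0 < Rpower x y) by (intros; apply exp_pos).
assert (He1 := exp_pos 1).
split; [repeat apply Rmult_lt_0_compat; auto with real; lra|].
intros n Hn.
assert (Hn1 : 1 <= INR n) by (apply (le_INR 1); lia).
set (r := 1 + / (2 * INR n)).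
assert (Hr : 1 < r <= 3 / 2).
{ assert (0 < / (2 * INR n) <= / 2); [|unfold r; lra].
  split; [apply Rinv_0_lt_compat; lra|apply Rinv_le_contravar; lra]. }
destruct (pow_dominated_gt_1 T HT Res HR r (proj1 Hr)) as [N0 HN0].
(* Large enough that [n * L] reaches [N0] and exceeds [n + k]. Since [N0] depends on [r], [L] varies
   with [n], which is harmless because the final bound is free of [L]. *)
set (L := (N0 + k + 2)%nat).
set (N := (n * L)%nat).
assert (HN : (N0 <= N /\ n + k < N)%nat) by (unfold N, L; nia).
assert (Hge : 0 <= psum (fun m => Rpower (INR (S m)) (- gamma)) n).
{ apply Rle_trans with (psum (fun _ : nat => 0) n).
  - rewrite psum_const; lra.
  - apply psum_le; intros; apply Rlt_le, Hpos. }
apply op_norm_le.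
2: { repeat apply Rmult_le_pos; auto with real; lra. }
intros x.
rewrite (cauchy_formula T HT Res HR r N n k x) by (lra || lia).
set (y := one_minus_pow T r N x).
assert (Hy : norm y <= 2 * norm x).
{ assert (HrN : 0 < r ^ N) by (apply pow_lt; lra).
  generalize (norm_triangle x (opp (RtoC (/ r ^ N) *: op_pow T N x))).
  change (norm y <= norm x + norm (opp (RtoC (/ r ^ N) *: op_pow T N x)) -> norm y <= 2 * norm x).
  rewrite norm_opp, norm_cscal, Cmod_R, Rabs_pos_eq by now apply Rlt_le, Rinv_0_lt_compat.
  assert (H := HN0 N (proj1 HN) x).
  apply Rmult_le_compat_l with (r := / r ^ N) in H; [|now apply Rlt_le, Rinv_0_lt_compat].
  rewrite <- Rmult_assoc, Rinv_l, Rmult_1_l in H; lra. }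
set (D := exp 1 * (K * Rpower (2 * INR n) beta) * (2 * norm x)).
assert (HD : 0 <= D).
{ unfold D; repeat apply Rmult_le_pos; auto with real; try lra; apply norm_ge_0. }
eapply Rle_trans.
{ apply (norm_mean _ (fun j => D * Rpower (Cmod (node r N j - 1)) (- gamma))).
  intros j Hj; rewrite norm_cscal.
  set (l := node r N j).
  assert (Hl : Cmod l = r) by (apply Cmod_polar; lra).
  assert (Hd : 0 < Cmod (l - 1)).
  { generalize (Cmod_polar_minus_1_ge_radius r (2 * PI * INR j / INR N)); fold (node r N j).
    fold l; lra. }
  assert (Hres : is_resolvent l T (Res l)) by (apply HR; lra).
  rewrite Cmod_mult, !Cmod_pow, Hl, Cmod_minus_comm, <- (Rpower_pow k) by easy.
  assert (H1 := pow_one_plus_half_inv_le n ltac:(lia)); fold r in H1.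
  assert (H2 := op_norm_bounded (Res l) (proj1 Hres) y).
  assert (H3 := HRK l ltac:(lra) (Res l) Hres); rewrite Hl in H3.
  replace (K / (Rpower (Cmod (l - 1)) alpha * Rpower (r - 1) beta))
    with (K * Rpower (2 * INR n) beta * Rpower (Cmod (l - 1)) (- alpha)) in H3.
  2: { replace (r - 1) with (/ (2 * INR n)) by (unfold r; ring).
    replace (Rpower (/ (2 * INR n)) beta) with (/ Rpower (2 * INR n) beta).
    - rewrite Rpower_Ropp; field; split; apply Rgt_not_eq, Hpos.
    - rewrite <- Rpower_Ropp; unfold Rpower; f_equal; rewrite ln_Rinv by lra; ring. }
  replace (- gamma) with (INR k + - alpha) by (unfold gamma; ring).
  rewrite Rpower_plus; unfold D.
  assert (H4 : norm (Res l y) <=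
    K * Rpower (2 * INR n) beta * Rpower (Cmod (l - 1)) (- alpha) * (2 * norm x)).
  { apply Rle_trans with (1 := H2).
    apply Rmult_le_compat; [apply op_norm_ge_0|apply norm_ge_0|easy|easy]. }
  apply Rle_trans with (exp 1 * Rpower (Cmod (l - 1)) (INR k) *
    (K * Rpower (2 * INR n) beta * Rpower (Cmod (l - 1)) (- alpha) * (2 * norm x))).
  - apply Rmult_le_compat; [|apply norm_ge_0| |easy].
    + apply Rmult_le_pos; [apply pow_le; lra|apply Rlt_le, Hpos].
    + apply Rmult_le_compat_r; [apply Rlt_le, Hpos|easy].
  - right; ring. }
rewrite psum_mult_l.
assert (Hs := mean_node_dist_Rpower_le gamma n L ltac:(unfold gamma; lra) ltac:(lia)
                ltac:(unfold L; lia)); fold r N in Hs.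
apply Rmult_le_compat_l with (1 := HD) in Hs.
replace (/ INR N * (D * psum (fun j => Rpower (Cmod (node r N j - 1)) (- gamma)) N))
  with (D * (/ INR N * psum (fun j => Rpower (Cmod (node r N j - 1)) (- gamma)) N)) by ring.
apply Rle_trans with (1 := Hs); right; unfold D.
rewrite <- Rpower_mult_distr by lra.
replace (alpha + beta - INR k - 1) with (beta + (gamma - 1)) by (unfold gamma; ring).
rewrite Rpower_plus; ring.
Qed.

Theorem theorem4p2 (alpha beta : R) (halpha : 0 < alpha) (hbeta : 0 <= beta)
    (hab : 1 < alpha + beta) (X : CompleteNormedModule C_AbsRing) (T : X -> X)
    (hT : RK_operator alpha beta T) (k : nat) :
  (INR k < alpha - 1 ->
    bigO (fun n => op_norm (fun x => op_pow T n (op_pow (scalar_minus 1 T) k x)))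
         (fun n => Rpower (INR n) (alpha + beta - INR k - 1)))
  /\
  (Z.of_nat k = Zceil (alpha - 1) ->
    ((exists m : nat, (1 <= m)%nat /\ alpha = INR m) ->
      bigO (fun n => op_norm (fun x => op_pow T n (op_pow (scalar_minus 1 T) k x)))
           (fun n => Rpower (INR n) beta * ln (INR n + 1)))
    /\
    ((~ exists m : nat, (1 <= m)%nat /\ alpha = INR m) ->
      bigO (fun n => op_norm (fun x => op_pow T n (op_pow (scalar_minus 1 T) k x)))
           (fun n => Rpower (INR n) beta))).
Proof.
(* Everything reduces to the sum of the powers [m^(-gamma)] with [gamma = alpha - k], in the regimes
   [gamma > 1], [gamma = 1] and [0 < gamma < 1]. *)
assert (Hbound : INR k <= alpha -> forall (C : R) (g : nat -> R), 0 < C ->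
  (forall n, (1 <= n)%nat -> Rpower (INR n) (alpha + beta - INR k - 1) *
    psum (fun m => Rpower (INR (S m)) (- (alpha - INR k))) n <= C * g n) ->
  bigO (fun n => op_norm (fun x => op_pow T n (op_pow (scalar_minus 1 T) k x))) g).
{ intros Hk C g HC Hg.
  destruct (RK_operator_power_bound T alpha beta k hbeta Hk hT) as [K [HK H]].
  exists (K * C); split; [now apply Rmult_lt_0_compat|].
  intros n Hn; apply Rle_trans with (1 := H n Hn).
  rewrite !Rmult_assoc; apply Rmult_le_compat_l; [lra|now apply Hg]. }
assert (Hpos : forall x y, 0 < Rpower x y) by (intros; apply exp_pos).
split; [|intros Hk; split].
- intros Hk; apply (Hbound ltac:(lra) (1 + / (alpha - INR k - 1))).
  + assert (0 < / (alpha - INR k - 1)) by (apply Rinv_0_lt_compat; lra); lra.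
  + intros n _; rewrite Rmult_comm; apply Rmult_le_compat_r; [apply Rlt_le, Hpos|].
    apply psum_Rpower_gt_1; lra.
- intros [m [Hm Halpha]].
  (* For integral [alpha] the ceiling is [alpha - 1] itself, so [gamma = 1] and the sum is
     harmonic. *)
  assert (Hkm : alpha = INR k + 1).
  { rewrite Halpha, <- S_INR; f_equal; apply Nat2Z.inj.
    rewrite Nat2Z.inj_succ, Hk, Halpha, INR_IZR_INZ.
    rewrite (Zceil_eq (Z.of_nat m - 1)); [lia|]; rewrite minus_IZR; lra. }
  apply (Hbound ltac:(lra) 3); [lra|].
  intros n Hn; replace (alpha + beta - INR k - 1) with beta by lra.
  rewrite <- Rmult_assoc, (Rmult_comm 3), Rmult_assoc.
  apply Rmult_le_compat_l; [apply Rlt_le, Hpos|].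
  rewrite (psum_ext _ (fun m => / INR (S m))); [now apply psum_harmonic|].
  intros j _; replace (alpha - INR k) with 1 by lra.
  rewrite Rpower_Ropp, Rpower_1; [easy|apply lt_0_INR; lia].
- intros Hni.
  assert (Hb := Zceil_bound (alpha - 1)); rewrite <- Hk, <- INR_IZR_INZ in Hb.
  (* The ceiling gives [k < alpha <= k + 1]; excluding equality leaves [0 < gamma < 1]. *)
  assert (Hne : alpha <> INR k + 1).
  { intros He; apply Hni; exists (S k); split; [lia|now rewrite S_INR]. }
  set (gamma := alpha - INR k) in *.
  assert (Hi : 0 < / (1 - gamma)) by (apply Rinv_0_lt_compat; unfold gamma; lra).
  apply (Hbound ltac:(lra) (1 + / (1 - gamma))); [lra|].
  intros n Hn.
  assert (Hn0 : 0 < INR n) by (apply lt_0_INR; lia).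
  apply Rle_trans with (Rpower (INR n) (beta + (gamma - 1)) *
    ((1 + / (1 - gamma)) * Rpower (INR n) (1 - gamma))).
  + replace (beta + (gamma - 1)) with (alpha + beta - INR k - 1) by (unfold gamma; ring).
    apply Rmult_le_compat_l; [apply Rlt_le, Hpos|].
    apply psum_Rpower_lt_1; [unfold gamma; lra|lia].
  + right; rewrite Rmult_comm, Rmult_assoc, <- Rpower_plus; do 2 f_equal; ring.
Qed.
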